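(* Let $(z_j)_{j\ge1}$ be a sequence of distinct points of the open unit disc $U$ with $\sum_{j=1}^\infty(1-|z_j|)=\infty$. Then there exists a sequence of positive numbers $(\eta_j)$ with $\lim_{j\to\infty}\eta_j=0$ such that for every bounded analytic function $f$ on $U$ that is not identically zero, \[ \limsup_{j\to\infty}\frac{|f(z_j)|}{\eta_j}=\infty . \] *)

(* Defs.v *)
From Stdlib Require Import Reals.
From Coquelicot Require Import Coquelicot.
Open Scope R_scope.

Definition in_disc (z : C) : Prop := Cmod z < 1.

Definition analytic_on_disc (f : C -> C) : Prop :=
  forall z : C, in_disc z -> @ex_derive C_AbsRing C_NormedModule f z.

Definition bounded_on_disc (f : C -> C) : Prop :=
  exists M : R, forall z : C, in_disc z -> Cmod (f z) <= M.

(* Main.v *)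
Require Import Defs.
From Stdlib Require Import Reals Lra Lia List FinFun Classical ClassicalEpsilon.
From Coquelicot Require Import Coquelicot.
Open Scope R_scope.

(** If [|f| <= M] on the disc and [|f| <= eps] at finitely many distinct points
    [a], dividing out one Blaschke factor after the other (Schwarz-Pick) gives
    [|f w| <= M prod |b_a w| + K eps], where [K] depends only on the points.
    Since the defects [1 - |z_j|] have infinite sum, for every [m] some finite
    window [z_m, ..., z_n] has total defect at least [m], which makes the product
    at most [exp (- c_w m)].  Choosing [eta_j <= 1 / ((m + 1) (K_m + 1))] for all
    [m <= j], a bound [|f (z_j)| <= C eta_j] for large [j] forces [f w = 0].

    The maximum principle needed for the division is derived from the bare
    existence of the complex derivative: Goursat's bisection argument, applied in
    the coordinate [log z], shows that the mean of [f] over a circle centred at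
    [0] does not depend on its radius.  Isolated points where the function is only
    continuous do no harm, because the mean is continuous in the radius. *)

(** * Continuity and complex differentiability *)

Definition ccont (f : C -> C) (z : C) : Prop :=
  forall eps, 0 < eps -> exists delta, 0 < delta /\
    forall w, Cmod (w - z) < delta -> Cmod (f w - f z) < eps.

(** Carathéodory's form of the derivative: [q] is a slope function and [q z] the derivative. Product
    and chain rule become identities between slopes, and [q] later provides the quotient of
    [f w - f z] by [w - z], including a value at [z]. *)
Definition cdiff (f : C -> C) (z : C) : Prop :=
  exists q : C -> C, ccont q z /\ forall w, (f w - f z = q w * (w - z))%C.

Lemma Cmod_minus_sym (a b : C) : Cmod (a - b) = Cmod (b - a).
Proof. rewrite <- Cmod_opp. f_equal. ring. Qed.

Lemma Cmod_minus_self (a : C) : Cmod (a - a) = 0.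
Proof. replace (a - a)%C with (RtoC 0) by ring. apply Cmod_0. Qed.

Lemma Cmod_triangle_rev (a b : C) : Cmod a - Cmod b <= Cmod (a - b).
Proof.
  pose proof (Cmod_triangle (a - b) b) as H.
  replace (a - b + b)%C with a in H by ring. lra.
Qed.

Lemma Cmod_triangle_minus (a b : C) : Cmod (a - b) <= Cmod a + Cmod b.
Proof. rewrite <- (Cmod_opp b). apply Cmod_triangle. Qed.

Lemma ccont_ext_near (f g : C -> C) (z : C) (d : R) :
  0 < d -> (forall w, Cmod (w - z) < d -> f w = g w) -> ccont f z -> ccont g z.
Proof.
  intros Hd Hfg Hf eps He. destruct (Hf eps He) as [del [Hdel H]].
  exists (Rmin d del). split; [now apply Rmin_glb_lt|].
  intros w Hw. rewrite <- !Hfg.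
  - apply H. apply Rlt_le_trans with (1 := Hw), Rmin_r.
  - rewrite Cmod_minus_self; lra.
  - apply Rlt_le_trans with (1 := Hw), Rmin_l.
Qed.

Lemma ccont_const (c z : C) : ccont (fun _ => c) z.
Proof. intros eps He. exists 1. split; [lra|]. intros. now rewrite Cmod_minus_self. Qed.

Lemma ccont_id (z : C) : ccont (fun w => w) z.
Proof. intros eps He. exists eps. auto. Qed.

Lemma ccont_plus (f g : C -> C) (z : C) :
  ccont f z -> ccont g z -> ccont (fun w => f w + g w)%C z.
Proof.
  intros Hf Hg eps He.
  destruct (Hf (eps / 2)) as [d1 [Hd1 H1]]; [lra|].
  destruct (Hg (eps / 2)) as [d2 [Hd2 H2]]; [lra|].
  exists (Rmin d1 d2). split; [now apply Rmin_glb_lt|]. intros w Hw.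
  specialize (H1 w (Rlt_le_trans _ _ _ Hw (Rmin_l _ _))).
  specialize (H2 w (Rlt_le_trans _ _ _ Hw (Rmin_r _ _))).
  replace (f w + g w - (f z + g z))%C with ((f w - f z) + (g w - g z))%C by ring.
  pose proof (Cmod_triangle (f w - f z) (g w - g z)). lra.
Qed.

Lemma ccont_mult (f g : C -> C) (z : C) :
  ccont f z -> ccont g z -> ccont (fun w => f w * g w)%C z.
Proof.
  intros Hf Hg eps He.
  pose proof (Cmod_ge_0 (f z)) as Pf. pose proof (Cmod_ge_0 (g z)) as Pg.
  (* The bound [e <= 1] makes the quadratic error term at most [e], so the three error terms below
     add up to less than [e * (Cmod (f z) + Cmod (g z) + 2)]. *)
  set (e := Rmin 1 (eps / (Cmod (f z) + Cmod (g z) + 2))).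
  assert (He' : 0 < e).
  { apply Rmin_glb_lt; [lra|]. apply Rdiv_lt_0_compat; lra. }
  assert (He1 : e <= 1) by apply Rmin_l.
  assert (He2 : e * (Cmod (f z) + Cmod (g z) + 2) <= eps).
  { apply Rle_trans with (eps / (Cmod (f z) + Cmod (g z) + 2) * (Cmod (f z) + Cmod (g z) + 2)).
    - apply Rmult_le_compat_r; [lra|apply Rmin_r].
    - right. field. lra. }
  destruct (Hf e He') as [d1 [Hd1 H1]]. destruct (Hg e He') as [d2 [Hd2 H2]].
  exists (Rmin d1 d2). split; [now apply Rmin_glb_lt|]. intros w Hw.
  specialize (H1 w (Rlt_le_trans _ _ _ Hw (Rmin_l _ _))).
  specialize (H2 w (Rlt_le_trans _ _ _ Hw (Rmin_r _ _))).
  replace (f w * g w - f z * g z)%C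
    with ((f w - f z) * (g w - g z) + (f w - f z) * g z + f z * (g w - g z))%C by ring.
  eapply Rle_lt_trans; [apply Cmod_triangle|].
  eapply Rle_lt_trans; [apply Rplus_le_compat_r, Cmod_triangle|].
  rewrite !Cmod_mult.
  pose proof (Cmod_ge_0 (f w - f z)). pose proof (Cmod_ge_0 (g w - g z)). nra.
Qed.

Lemma ccont_inv (g : C -> C) (z : C) :
  g z <> 0 -> ccont g z -> ccont (fun w => / g w)%C z.
Proof.
  intros Hz Hg eps He.
  assert (Pg : 0 < Cmod (g z)) by now apply Cmod_gt_0.
  assert (Pe : 0 < eps * (Cmod (g z) * Cmod (g z)) / 2).
  { assert (0 < Cmod (g z) * Cmod (g z)) by nra. nra. }
  destruct (Hg (Rmin (Cmod (g z) / 2) (eps * (Cmod (g z) * Cmod (g z)) / 2))) as [d [Hd H]].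
  { apply Rmin_glb_lt; lra. }
  exists d. split; [easy|]. intros w Hw. specialize (H w Hw).
  pose proof (Rmin_l (Cmod (g z) / 2) (eps * (Cmod (g z) * Cmod (g z)) / 2)).
  pose proof (Rmin_r (Cmod (g z) / 2) (eps * (Cmod (g z) * Cmod (g z)) / 2)).
  pose proof (Cmod_triangle_rev (g z) (g w)) as T. rewrite Cmod_minus_sym in T.
  assert (Pw : Cmod (g z) / 2 < Cmod (g w)) by lra.
  assert (Hw0 : g w <> 0) by (apply Cmod_gt_0; lra).
  replace (/ g w - / g z)%C with ((g z - g w) / (g w * g z))%C
    by (field; now split).
  rewrite Cmod_div by now apply Cmult_neq_0. rewrite Cmod_mult, Cmod_minus_sym.
  apply Rmult_lt_reg_r with (Cmod (g w) * Cmod (g z)); [nra|].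
  unfold Rdiv. rewrite Rmult_assoc, Rinv_l by nra.
  assert (eps * (Cmod (g z) / 2 * Cmod (g z)) <= eps * (Cmod (g w) * Cmod (g z))).
  { apply Rmult_le_compat_l; nra. }
  lra.
Qed.

Lemma ccont_comp (f g : C -> C) (z : C) :
  ccont f (g z) -> ccont g z -> ccont (fun w => f (g w)) z.
Proof.
  intros Hf Hg eps He. destruct (Hf eps He) as [d [Hd H]].
  destruct (Hg d Hd) as [d' [Hd' H']]. exists d'. split; auto.
Qed.

Lemma cdiff_ccont (f : C -> C) (z : C) : cdiff f z -> ccont f z.
Proof.
  intros [q [Hq H]].
  apply ccont_ext_near with (f := fun w => (f z + q w * (w + - z))%C) (d := 1); [lra| |].
  - intros w _. replace (q w * (w + - z))%C with (f w - f z)%C by (rewrite H; ring). ring.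
  - auto using ccont_plus, ccont_const, ccont_mult, ccont_id.
Qed.

(* Away from [z] the slope in [cdiff] is the difference quotient, so it only
   has to be controlled near [z]. *)
Lemma cdiff_near (f q : C -> C) (z : C) (d : R) :
  0 < d -> ccont q z ->
  (forall w, Cmod (w - z) < d -> (f w - f z = q w * (w - z))%C) -> cdiff f z.
Proof.
  intros Hd Hq H.
  exists (fun w => if excluded_middle_informative (Cmod (w - z) < d) then q w
                   else ((f w - f z) / (w - z))%C). split.
  - apply ccont_ext_near with (f := q) (d := d); trivial.
    intros w Hw. now destruct excluded_middle_informative.
  - intros w. destruct excluded_middle_informative as [Hw|Hw]; [auto|].
    field. apply Cmod_gt_0. lra.
Qed.

Lemma cdiff_ext_near (f g : C -> C) (z : C) (d : R) :
  0 < d -> (forall w, Cmod (w - z) < d -> f w = g w) -> cdiff f z -> cdiff g z.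
Proof.
  intros Hd Hfg [q [Hq H]]. apply cdiff_near with (q := q) (d := d); trivial.
  intros w Hw. rewrite <- !Hfg; trivial. rewrite Cmod_minus_self; lra.
Qed.

Lemma cdiff_const (c z : C) : cdiff (fun _ => c) z.
Proof. exists (fun _ => 0)%C. split; [apply ccont_const|]. intros; ring. Qed.

Lemma cdiff_id (z : C) : cdiff (fun w => w) z.
Proof. exists (fun _ => 1)%C. split; [apply ccont_const|]. intros; ring. Qed.

Lemma cdiff_plus (f g : C -> C) (z : C) :
  cdiff f z -> cdiff g z -> cdiff (fun w => f w + g w)%C z.
Proof.
  intros [p [Hp Ep]] [q [Hq Eq]]. exists (fun w => p w + q w)%C.
  split; [now apply ccont_plus|]. intros w.
  replace (f w + g w - (f z + g z))%C with ((f w - f z) + (g w - g z))%C by ring.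
  rewrite Ep, Eq. ring.
Qed.

Lemma cdiff_mult (f g : C -> C) (z : C) :
  cdiff f z -> cdiff g z -> cdiff (fun w => f w * g w)%C z.
Proof.
  intros Hf Hg. pose proof (cdiff_ccont _ _ Hf) as Cf.
  destruct Hf as [p [Hp Ep]]. destruct Hg as [q [Hq Eq]].
  exists (fun w => p w * g z + f w * q w)%C. split.
  - auto using ccont_plus, ccont_mult, ccont_const.
  - intros w.
    replace (f w * g w - f z * g z)%C with ((f w - f z) * g z + f w * (g w - g z))%C by ring.
    rewrite Ep, Eq. ring.
Qed.

Lemma cdiff_inv (g : C -> C) (z : C) :
  g z <> 0 -> cdiff g z -> cdiff (fun w => / g w)%C z.
Proof.
  intros Hz Hg. pose proof (cdiff_ccont _ _ Hg) as Cg. destruct Hg as [q [Hq Eq]].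
  destruct (Cg (Cmod (g z))) as [d [Hd H]]; [now apply Cmod_gt_0|].
  apply cdiff_near with (q := fun w => (- (1) * q w * (/ g w * / g z))%C) (d := d); trivial.
  - auto using ccont_mult, ccont_const, ccont_inv.
  - intros w Hw. specialize (H w Hw).
    assert (g w <> 0).
    { intros E. rewrite E in H. replace (0 - g z)%C with (- g z)%C in H by ring.
      rewrite Cmod_opp in H. lra. }
    replace (/ g w - / g z)%C with (- (1) * (g w - g z) * (/ g w * / g z))%C
      by (field; now split).
    rewrite Eq. ring.
Qed.

Lemma cdiff_comp (f g : C -> C) (z : C) :
  cdiff f (g z) -> cdiff g z -> cdiff (fun w => f (g w)) z.
Proof.
  intros Hf Hg. pose proof (cdiff_ccont _ _ Hg) as Cg.
  destruct Hf as [p [Hp Ep]]. destruct Hg as [q [Hq Eq]].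
  exists (fun w => p (g w) * q w)%C. split.
  - apply ccont_mult; trivial. now apply ccont_comp.
  - intros w. rewrite Ep, Eq. ring.
Qed.

Lemma cdiff_eps (f : C -> C) (z l : C) :
  (forall eps, 0 < eps -> exists d, 0 < d /\ forall w, Cmod (w - z) < d ->
     Cmod (f w - f z - l * (w - z)) <= eps * Cmod (w - z)) ->
  cdiff f z.
Proof.
  intros H.
  set (q := fun w => if excluded_middle_informative (w = z) then l
                     else ((f w - f z) / (w - z))%C).
  exists q. split.
  - intros eps He. destruct (H (eps / 2)) as [d [Hd Hw]]; [lra|].
    exists d. split; [easy|]. intros w Hwz. unfold q.
    destruct (excluded_middle_informative (z = z)) as [_|n]; [|now destruct n].
    destruct excluded_middle_informative as [->|n].
    + rewrite Cmod_minus_self. lra.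
    + specialize (Hw w Hwz).
      assert (Hn : (w - z)%C <> 0).
      { intros E. apply n. replace w with ((w - z) + z)%C by ring. rewrite E. ring. }
      pose proof (proj1 (Cmod_gt_0 _) Hn).
      replace ((f w - f z) / (w - z) - l)%C
        with ((f w - f z - l * (w - z)) / (w - z))%C by (field; exact Hn).
      rewrite Cmod_div by exact Hn.
      apply Rle_lt_trans with (eps / 2); [|lra].
      apply Rmult_le_reg_r with (Cmod (w - z)); [lra|].
      unfold Rdiv at 1. rewrite Rmult_assoc, Rinv_l by lra. lra.
  - intros w. unfold q. destruct excluded_middle_informative as [->|n].
    + ring.
    + field. intros E. apply n. replace w with ((w - z) + z)%C by ring. rewrite E. ring.
Qed.

Lemma ex_derive_cdiff (f : C -> C) (z : C) :
  @ex_derive C_AbsRing C_NormedModule f z -> cdiff f z.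
Proof.
  intros [l [_ Hl]]. apply cdiff_eps with l. intros eps He.
  (* The identity function proves that the neighbourhood filter of [z] converges to [z]. *)
  destruct (Hl z (fun P H => H) (mkposreal eps He)) as [d Hd].
  exists d. split; [apply cond_pos|]. intros w Hw.
  specialize (Hd w Hw).
  rewrite (Cmult_comm l). exact Hd.
Qed.

(** * Goursat's theorem on rectangles *)

Lemma pow_half_small (h d : R) : 0 < d -> exists n, h * (/ 2) ^ n < d.
Proof.
  intros Hd.
  assert (L : is_lim_seq (fun n => h * (/ 2) ^ n) (h * 0)).
  { apply is_lim_seq_mult'; [apply is_lim_seq_const|].
    apply is_lim_seq_geom. rewrite Rabs_pos_eq; lra. }
  rewrite Rmult_0_r in L. apply is_lim_seq_spec in L.
  destruct (L (mkposreal d Hd)) as [N H]. exists N.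
  specialize (H N (Nat.le_refl _)). rewrite Rminus_0_r in H.
  apply Rle_lt_trans with (2 := H), Rle_abs.
Qed.

(** The intervals from [x n] to [x n + h / 2^n] are nested: [l] is the limit of the increasing left
    ends and stays below every right end because these decrease. *)
Lemma nested_halving_limit (x : nat -> R) (h : R) :
  0 <= h ->
  (forall n, x n <= x (S n) <= x n + h * (/ 2) ^ S n) ->
  exists l, forall n, x n <= l <= x n + h * (/ 2) ^ n.
Proof.
  intros Hh Hx.
  assert (P : forall n, 0 <= h * (/ 2) ^ n).
  { intros n. apply Rmult_le_pos; [easy|]. apply pow_le. lra. }
  assert (U : forall k n, x n <= x (n + k)%nat /\
                x (n + k)%nat + h * (/ 2) ^ (n + k) <= x n + h * (/ 2) ^ n).
  { induction k as [|k IH]; intros n.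
    - rewrite Nat.add_0_r. lra.
    - rewrite Nat.add_succ_r. destruct (IH n) as [I1 I2].
      destruct (Hx (n + k)%nat) as [J1 J2]. cbn [pow] in *.
      specialize (P (n + k)%nat). lra. }
  destruct (ex_finite_lim_seq_incr x (x O + h)) as [l Hl].
  - intros n. apply Hx.
  - intros n. destruct (U n O) as [_ U2]. cbn [Nat.add] in U2.
    specialize (P n). simpl pow in U2 at 2. lra.
  - exists l. intros n. split.
    + apply (is_lim_seq_incr_compare x l Hl). intros m; apply Hx.
    + apply (is_lim_seq_le_loc x (fun _ => x n + h * (/ 2) ^ n) l (x n + h * (/ 2) ^ n));
        [|exact Hl|apply is_lim_seq_const].
      exists n. intros m Hm. destruct (U (m - n)%nat n) as [_ U2].
      replace (n + (m - n))%nat with m in U2 by lia. specialize (P m). lra.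
Qed.

(** Goursat's bisection for an abstract additive function of rectangles. Some quarter carries at
    least a quarter of [|Q|]; after [n] steps the factor [4 ^ n] is exactly cancelled by the square
    in the local bound at the limit point, so [|Q|] is at most every [eps] times a fixed
    constant. *)
Lemma rectangle_bisection (Q : R -> R -> R -> R -> R) (s0 s1 t0 t1 : R) :
  s0 <= s1 -> t0 <= t1 ->
  (forall a m b c d, s0 <= a <= m -> m <= b <= s1 -> t0 <= c <= d -> d <= t1 ->
     Q a b c d = Q a m c d + Q m b c d) ->
  (forall a b c m d, s0 <= a <= b -> b <= s1 -> t0 <= c <= m -> m <= d <= t1 ->
     Q a b c d = Q a b c m + Q a b m d) ->
  (forall s t, s0 <= s <= s1 -> t0 <= t <= t1 -> forall eps, 0 < eps ->
     exists del, 0 < del /\ forall a b c d,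
       s0 <= a <= s -> s <= b <= s1 -> t0 <= c <= t -> t <= d <= t1 ->
       b - a < del -> d - c < del ->
       Rabs (Q a b c d) <= eps * ((b - a) + (d - c)) ^ 2) ->
  Q s0 s1 t0 t1 = 0.
Proof.
  intros Hs Ht Hadds Haddt Hloc.
  set (h := fun n => (s1 - s0) * (/ 2) ^ n). set (k := fun n => (t1 - t0) * (/ 2) ^ n).
  set (q := fun n (p : R * R) =>
    Rabs (Q (fst p) (fst p + h n) (snd p) (snd p + k n))).
  set (good := fun n (p p' : R * R) =>
    (fst p <= fst p' <= fst p + h (S n)) /\ (snd p <= snd p' <= snd p + k (S n)) /\
    q n p <= 4 * q (S n) p').
  assert (Ph : forall n, 0 <= h n).
  { intros n. apply Rmult_le_pos; [lra|]. apply pow_le. lra. }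
  assert (Pk : forall n, 0 <= k n).
  { intros n. apply Rmult_le_pos; [lra|]. apply pow_le. lra. }
  assert (Dh : forall n, h n = h (S n) + h (S n)) by (intros n; unfold h; simpl; lra).
  assert (Dk : forall n, k n = k (S n) + k (S n)) by (intros n; unfold k; simpl; lra).
  assert (Hgood : forall n p, s0 <= fst p -> fst p + h n <= s1 ->
            t0 <= snd p -> snd p + k n <= t1 -> exists p', good n p p').
  { intros n [x y]; cbn [fst snd]; intros A1 A2 B1 B2.
    pose proof (Ph (S n)). pose proof (Pk (S n)).
    (* If no quarter were good, each of the four would have less than a quarter of the total,
       against additivity. *)
    apply NNPP. intros N.
    assert (F : forall x' y', (x' = x \/ x' = x + h (S n)) -> (y' = y \/ y' = y + k (S n)) ->
              4 * Rabs (Q x' (x' + h (S n)) y' (y' + k (S n))) < Rabs (Q x (x + h n) y (y + k n))).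
    { intros x' y' X Y. apply Rnot_le_lt. intros L. apply N. exists (x', y').
      unfold good, q; cbn [fst snd]. lra. }
    pose proof (F x y (or_introl eq_refl) (or_introl eq_refl)) as F1.
    pose proof (F x _ (or_introl eq_refl) (or_intror eq_refl)) as F2.
    pose proof (F _ y (or_intror eq_refl) (or_introl eq_refl)) as F3.
    pose proof (F _ _ (or_intror eq_refl) (or_intror eq_refl)) as F4.
    rewrite (Dh n) in A2. rewrite (Dk n) in B2.
    assert (E : Q x (x + h n) y (y + k n) =
      Q x (x + h (S n)) y (y + k (S n)) +
      Q x (x + h (S n)) (y + k (S n)) (y + k (S n) + k (S n)) +
      (Q (x + h (S n)) (x + h (S n) + h (S n)) y (y + k (S n)) +
       Q (x + h (S n)) (x + h (S n) + h (S n)) (y + k (S n)) (y + k (S n) + k (S n)))).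
    { rewrite (Dh n), (Dk n), <- !Rplus_assoc.
      rewrite (Hadds x (x + h (S n))) by lra.
      rewrite (Haddt x _ y (y + k (S n))) by lra.
      rewrite (Haddt (x + h (S n)) _ y (y + k (S n))) by lra. lra. }
    rewrite E in F1, F2, F3, F4.
    match type of F1 with _ < Rabs (?A + ?B + (?C + ?D)) =>
      pose proof (Rabs_triang (A + B) (C + D)); pose proof (Rabs_triang A B);
      pose proof (Rabs_triang C D) end.
    lra. }
  (* The corners are picked by Hilbert's epsilon; inside [epsilon] the pair [(s0, t0)] only shows
     that the type is inhabited. *)
  set (p := fix p n := match n with
              | O => (s0, t0)
              | S n => epsilon (inhabits (s0, t0)) (good n (p n)) end).
  assert (Hp : forall n, (s0 <= fst (p n) /\ fst (p n) + h n <= s1 /\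
                          t0 <= snd (p n) /\ snd (p n) + k n <= t1)).
  { induction n as [|n IH].
    - unfold h, k. simpl. lra.
    - destruct IH as [I1 [I2 [I3 I4]]].
      pose proof (epsilon_spec (inhabits (s0, t0)) _ (Hgood n (p n) I1 I2 I3 I4)) as G.
      change (epsilon (inhabits (s0, t0)) (good n (p n))) with (p (S n)) in G.
      destruct G as [G1 [G2 _]]. rewrite (Dh n) in I2. rewrite (Dk n) in I4. lra. }
  assert (G : forall n, good n (p n) (p (S n))).
  { intros n. destruct (Hp n) as [I1 [I2 [I3 I4]]].
    apply (epsilon_spec (inhabits (s0, t0)) _ (Hgood n (p n) I1 I2 I3 I4)). }
  assert (Hq : forall n, Rabs (Q s0 s1 t0 t1) <= 4 ^ n * q n (p n)).
  { induction n as [|n IH].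
    - unfold q, h, k. simpl. rewrite !Rmult_1_r, Rmult_1_l.
      replace (s0 + (s1 - s0)) with s1 by ring. replace (t0 + (t1 - t0)) with t1 by ring. lra.
    - destruct (G n) as [_ [_ G3]]. simpl pow.
      assert (0 < 4 ^ n) by (apply pow_lt; lra). nra. }
  destruct (nested_halving_limit (fun n => fst (p n)) (s1 - s0)) as [s Hsl]; [lra| |].
  { intros n. apply G. }
  destruct (nested_halving_limit (fun n => snd (p n)) (t1 - t0)) as [t Htl]; [lra| |].
  { intros n. apply G. }
  fold h k in Hsl, Htl.
  assert (Hz : forall eps, 0 < eps -> Rabs (Q s0 s1 t0 t1) <= eps * ((s1 - s0) + (t1 - t0)) ^ 2).
  { intros eps He.
    assert (Is : s0 <= s <= s1).
    { specialize (Hsl O). destruct (Hp O) as [I1 [I2 _]]. unfold h in Hsl. simpl in *. lra. }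
    assert (It : t0 <= t <= t1).
    { specialize (Htl O). destruct (Hp O) as [_ [_ I2]]. unfold k in Htl. simpl in *. lra. }
    destruct (Hloc s t Is It eps He) as [del [Hdel Hb]].
    destruct (pow_half_small ((s1 - s0) + (t1 - t0)) del Hdel) as [n Hn].
    assert (P2 : 0 < (/ 2) ^ n) by (apply pow_lt; lra).
    pose proof (Hp n) as I. specialize (Hsl n). specialize (Htl n). cbn beta in Hsl, Htl.
    assert (B : q n (p n) <= eps * (h n + k n) ^ 2).
    { unfold q.
      replace (h n + k n) with ((fst (p n) + h n - fst (p n)) + (snd (p n) + k n - snd (p n)))
        by ring.
      apply Hb; unfold h, k in *; nra. }
    apply Rle_trans with (1 := Hq n).
    apply Rle_trans with (4 ^ n * (eps * (h n + k n) ^ 2)).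
    { apply Rmult_le_compat_l; [|easy]. apply pow_le. lra. }
    right. unfold h, k. rewrite <- Rmult_plus_distr_r, Rpow_mult_distr, <- pow_mult.
    rewrite (Nat.mul_comm n), pow_mult.
    replace ((/ 2) ^ 2) with (/ 4) by field.
    rewrite pow_inv. field. apply pow_nonzero. lra. }
  set (S := ((s1 - s0) + (t1 - t0)) ^ 2) in Hz.
  assert (0 <= S) by apply pow2_ge_0.
  assert (Rabs (Q s0 s1 t0 t1) <= 0).
  { apply Rnot_lt_le. intros N.
    (* This [eps] would give [|Q| <= |Q| / 2]; the added 1 covers [S = 0]. *)
    specialize (Hz (Rabs (Q s0 s1 t0 t1) / (2 * (S + 1)))).
    assert (0 < Rabs (Q s0 s1 t0 t1) / (2 * (S + 1))) by (apply Rdiv_lt_0_compat; lra).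
    specialize (Hz H0).
    assert (Rabs (Q s0 s1 t0 t1) / (2 * (S + 1)) * (2 * (S + 1)) = Rabs (Q s0 s1 t0 t1))
      by (field; lra).
    nra. }
  apply Rabs_eq_0. pose proof (Rabs_pos (Q s0 s1 t0 t1)). lra.
Qed.

Lemma continuity_2d_ex_RInt_snd (f : R -> R -> R) (x a b : R) :
  a <= b -> (forall y, a <= y <= b -> continuity_2d_pt f x y) -> ex_RInt (f x) a b.
Proof.
  intros Hab H. apply (ex_RInt_continuous (V := R_CompleteNormedModule)).
  rewrite Rmin_left, Rmax_right by easy. intros y Hy.
  apply continuity_pt_filterlim. intros eps He.
  destruct (H y Hy (mkposreal eps He)) as [d Hd]. exists d. split; [apply cond_pos|].
  intros z [_ Hz]. apply Hd; [|exact Hz]. rewrite Rminus_diag, Rabs_R0. apply cond_pos.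
Qed.

Lemma continuity_2d_ex_RInt_fst (f : R -> R -> R) (y a b : R) :
  a <= b -> (forall x, a <= x <= b -> continuity_2d_pt f x y) -> ex_RInt (fun x => f x y) a b.
Proof.
  intros Hab H. apply (continuity_2d_ex_RInt_snd (fun y x => f x y)); trivial.
  intros x Hx eps. destruct (H x Hx eps) as [d Hd]. exists d. auto.
Qed.

Lemma RInt_minus_const (f : R -> R) (a b c : R) :
  ex_RInt f a b -> RInt (fun x => f x - c) a b = RInt f a b - (b - a) * c.
Proof.
  intros Hf. apply is_RInt_unique.
  apply (is_RInt_minus (V := R_NormedModule) f (fun _ => c) a b _ ((b - a) * c)).
  - now apply (RInt_correct (V := R_CompleteNormedModule)).
  - apply (is_RInt_const (V := R_NormedModule)).
Qed.

(* Goursat's theorem in real form.  The number [a] is the common value of the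
   partial derivatives u_s = v_t, and the conclusion is Green's formula for
   the closed form v ds + u dt. *)
Lemma goursat_rectangle (u v : R -> R -> R) (s0 s1 t0 t1 : R) :
  s0 <= s1 -> t0 <= t1 ->
  (forall s t, s0 <= s <= s1 -> t0 <= t <= t1 ->
     continuity_2d_pt u s t /\ continuity_2d_pt v s t) ->
  (forall s t, s0 <= s <= s1 -> t0 <= t <= t1 ->
     exists r, forall eps, 0 < eps -> exists del, 0 < del /\ forall a b c d,
       a <= s <= b -> c <= t <= d -> b - a < del -> d - c < del ->
       (forall y, c <= y <= d ->
          Rabs (u b y - u a y - r * (b - a)) <= eps * ((b - a) + (d - c))) /\
       (forall x, a <= x <= b ->
          Rabs (v x d - v x c - r * (d - c)) <= eps * ((b - a) + (d - c)))) ->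
  RInt (fun t => u s1 t - u s0 t) t0 t1 = RInt (fun s => v s t1 - v s t0) s0 s1.
Proof.
  intros Hs Ht Hc Hd.
  (* [Q] is the counterclockwise integral of v ds + u dt along the boundary of the rectangle. *)
  set (Q := fun a b c d => RInt (fun t => u b t - u a t) c d - RInt (fun s => v s d - v s c) a b).
  assert (Eu : forall x c d, s0 <= x <= s1 -> t0 <= c -> c <= d -> d <= t1 ->
             ex_RInt (u x) c d).
  { intros. apply continuity_2d_ex_RInt_snd; [easy|]. intros. apply Hc; lra. }
  assert (Ev : forall y a b, t0 <= y <= t1 -> s0 <= a -> a <= b -> b <= s1 ->
             ex_RInt (fun x => v x y) a b).
  { intros. apply continuity_2d_ex_RInt_fst; [easy|]. intros. apply Hc; lra. }
  assert (EU : forall x x' c d, s0 <= x <= s1 -> s0 <= x' <= s1 -> t0 <= c -> c <= d -> d <= t1 ->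
             ex_RInt (fun t => u x t - u x' t) c d).
  { intros. apply (ex_RInt_minus (V := R_NormedModule)); auto. }
  assert (EV : forall y y' a b, t0 <= y <= t1 -> t0 <= y' <= t1 -> s0 <= a -> a <= b -> b <= s1 ->
             ex_RInt (fun s => v s y - v s y') a b).
  { intros. apply (ex_RInt_minus (V := R_NormedModule) (fun s => v s y) (fun s => v s y')); auto. }
  assert (DU : forall x x' c d, s0 <= x <= s1 -> s0 <= x' <= s1 -> t0 <= c -> c <= d -> d <= t1 ->
             RInt (fun t => u x t - u x' t) c d = RInt (u x) c d - RInt (u x') c d).
  { intros. apply (RInt_minus (V := R_CompleteNormedModule)); auto. }
  assert (DV : forall y y' a b, t0 <= y <= t1 -> t0 <= y' <= t1 -> s0 <= a -> a <= b -> b <= s1 ->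
             RInt (fun s => v s y - v s y') a b
             = RInt (fun s => v s y) a b - RInt (fun s => v s y') a b).
  { intros. apply (RInt_minus (V := R_CompleteNormedModule) (fun s => v s y) (fun s => v s y')); auto. }
  enough (E : Q s0 s1 t0 t1 = 0) by (unfold Q in E; lra).
  apply rectangle_bisection; trivial.
  - intros a m b c d H1 H2 H3 H4. unfold Q.
    rewrite !DU, !DV by lra.
    rewrite <- (RInt_Chasles (fun s => v s d) a m b) by (apply Ev; lra).
    rewrite <- (RInt_Chasles (fun s => v s c) a m b) by (apply Ev; lra).
    unfold plus; simpl. lra.
  - intros a b c m d H1 H2 H3 H4. unfold Q.
    rewrite !DU, !DV by lra.
    rewrite <- (RInt_Chasles (u b) c m d) by (apply Eu; lra).
    rewrite <- (RInt_Chasles (u a) c m d) by (apply Eu; lra).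
    unfold plus; simpl. lra.
  - intros s t Is It eps He. destruct (Hd s t Is It) as [r Hr].
    destruct (Hr eps He) as [del [Hdel H]]. exists del. split; [easy|].
    intros a b c d A B C D Hba Hdc.
    destruct (H a b c d) as [HU HV]; try lra.
    assert (IU : Rabs (RInt (fun y => u b y - u a y - r * (b - a)) c d)
              <= (d - c) * (eps * ((b - a) + (d - c)))).
    { apply abs_RInt_le_const; [lra| |exact HU].
      apply (ex_RInt_minus (V := R_NormedModule)); [apply EU; lra|apply ex_RInt_const]. }
    assert (IV : Rabs (RInt (fun x => v x d - v x c - r * (d - c)) a b)
              <= (b - a) * (eps * ((b - a) + (d - c)))).
    { apply abs_RInt_le_const; [lra| |exact HV].
      apply (ex_RInt_minus (V := R_NormedModule)); [apply EV; lra|apply ex_RInt_const]. }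
    rewrite RInt_minus_const in IU by (apply EU; lra).
    rewrite RInt_minus_const in IV by (apply EV; lra).
    unfold Q.
    set (X := RInt _ c d) in *. set (Y := RInt _ a b) in *.
    set (e := (b - a) + (d - c)) in *.
    (* Both integrals have the main term [r] times the area of the rectangle; the two cancel and
       only the errors remain. *)
    replace (X - Y) with ((X - (d - c) * (r * (b - a))) + - (Y - (b - a) * (r * (d - c))))
      by ring.
    apply Rle_trans with ((d - c) * (eps * e) + (b - a) * (eps * e)).
    + eapply Rle_trans; [apply Rabs_triang|]. rewrite Rabs_Ropp. lra.
    + right. unfold e. ring.
Qed.

(** * The mean value property *)

Lemma exp_le_mono (x y : R) : x <= y -> exp x <= exp y.
Proof.
  intros [H| ->]; [left; now apply exp_increasing|apply Rle_refl].
Qed.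

(** * The complex exponential and its derivative *)

Definition cexp (p : C) : C := (exp (fst p) * cos (snd p), exp (fst p) * sin (snd p)).

Lemma Cmod_le_abs_sum (z : C) : Cmod z <= Rabs (fst z) + Rabs (snd z).
Proof.
  destruct z as [x y]; cbn [fst snd].
  replace ((x, y) : C) with (RtoC x + Ci * RtoC y)%C
    by (apply injective_projections; simpl; ring).
  eapply Rle_trans; [apply Cmod_triangle|].
  rewrite Cmod_mult, Cmod_Ci, !Cmod_R. lra.
Qed.

Lemma abs_fst_le_Cmod (z : C) : Rabs (fst z) <= Cmod z.
Proof. eapply Rle_trans; [apply Rmax_l|apply Rmax_Cmod]. Qed.

Lemma abs_snd_le_Cmod (z : C) : Rabs (snd z) <= Cmod z.
Proof. eapply Rle_trans; [apply Rmax_r|apply Rmax_Cmod]. Qed.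

Lemma cexp_plus (p q : C) : cexp (p + q) = (cexp p * cexp q)%C.
Proof.
  unfold cexp. apply injective_projections; simpl;
    rewrite exp_plus, ?cos_plus, ?sin_plus; ring.
Qed.

Lemma Cmod_cexp (p : C) : Cmod (cexp p) = exp (fst p).
Proof.
  unfold Cmod, cexp; cbn [fst snd].
  replace ((exp (fst p) * cos (snd p)) ^ 2 + (exp (fst p) * sin (snd p)) ^ 2)
    with (exp (fst p) * exp (fst p) * (Rsqr (sin (snd p)) + Rsqr (cos (snd p))))
    by (unfold Rsqr; ring).
  rewrite sin2_cos2, Rmult_1_r. apply sqrt_square. left. apply exp_pos.
Qed.

Lemma derivable_pt_lim_linear_bound (f : R -> R) (x l : R) :
  derivable_pt_lim f x l -> forall eps, 0 < eps -> exists d, 0 < d /\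
    forall h, Rabs h < d -> Rabs (f (x + h) - f x - l * h) <= eps * Rabs h.
Proof.
  intros H eps He. destruct (H eps He) as [d Hd]. exists d. split; [apply cond_pos|].
  intros h Hh. destruct (Req_dec h 0) as [->|N].
  - replace (f (x + 0) - f x - l * 0) with 0 by (rewrite Rplus_0_r; ring). rewrite Rabs_R0. lra.
  - specialize (Hd h N Hh).
    replace (f (x + h) - f x - l * h) with (((f (x + h) - f x) / h - l) * h) by (field; easy).
    rewrite Rabs_mult. apply Rmult_le_compat_r; [apply Rabs_pos|lra].
Qed.

Lemma cexp_linear_bound (eps : R) :
  0 < eps -> exists d, 0 < d /\
    forall p, Cmod p < d -> Cmod (cexp p - 1 - p) <= eps * Cmod p.
Proof.
  (* In units of [e * Cmod p], the real part costs 1 + 2 and the imaginary part 1 + 2 + 1, hence the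
     7. *)
  intros He. set (e := eps / 7). assert (He' : 0 < e) by (unfold e; lra).
  destruct (derivable_pt_lim_linear_bound _ _ _ derivable_pt_lim_exp_0 e He') as [d1 [P1 H1]].
  destruct (derivable_pt_lim_linear_bound _ _ _ (derivable_pt_lim_cos 0) e He') as [d2 [P2 H2]].
  destruct (derivable_pt_lim_linear_bound _ _ _ (derivable_pt_lim_sin 0) e He') as [d3 [P3 H3]].
  (* The bound by [e] serves the product [x * y], the bound by 1 gives [|1 + x| <= 2]. *)
  exists (Rmin (Rmin d1 d2) (Rmin d3 (Rmin e 1))).
  split; [repeat apply Rmin_glb_lt; lra|].
  intros p Hp.
  pose proof (abs_fst_le_Cmod p) as A1. pose proof (abs_snd_le_Cmod p) as A2.
  assert (B : Cmod p < d1 /\ Cmod p < d2 /\ Cmod p < d3 /\ Cmod p < e /\ Cmod p < 1).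
  { revert Hp. unfold Rmin. repeat destruct Rle_dec; lra. }
  destruct p as [x y]; cbn [fst snd] in *.
  specialize (H1 x). specialize (H2 y). specialize (H3 y).
  rewrite Rplus_0_l, exp_0 in H1. rewrite Rplus_0_l, cos_0, sin_0 in H2.
  rewrite Rplus_0_l, sin_0, cos_0 in H3.
  specialize (H1 ltac:(lra)). specialize (H2 ltac:(lra)). specialize (H3 ltac:(lra)).
  set (r := Cmod (x, y)) in *.
  replace (exp x - 1 - 1 * x) with (exp x - 1 - x) in H1 by ring.
  replace (cos y - 1 - - 0 * y) with (cos y - 1) in H2 by ring.
  replace (sin y - 0 - 1 * y) with (sin y - y) in H3 by ring.
  pose proof (Rabs_pos x) as Px. pose proof (Rabs_pos y) as Py.
  assert (Hx1 : Rabs (1 + x) <= 2).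
  { eapply Rle_trans; [apply Rabs_triang|]. rewrite Rabs_R1. lra. }
  assert (Hc : Rabs (cos y) <= 1) by (apply Rabs_le; pose proof (COS_bound y); lra).
  assert (Hs : Rabs (sin y) <= 1) by (apply Rabs_le; pose proof (SIN_bound y); lra).
  eapply Rle_trans; [apply Cmod_le_abs_sum|]. unfold cexp; simpl.
  replace (exp x * cos y + - (1) + - x)
    with ((exp x - 1 - x) * cos y + (1 + x) * (cos y - 1)) by ring.
  replace (exp x * sin y + - 0 + - y)
    with ((exp x - 1 - x) * sin y + (1 + x) * (sin y - y) + x * y) by ring.
  assert (T1 : Rabs ((exp x - 1 - x) * cos y) <= e * r).
  { rewrite Rabs_mult. pose proof (Rabs_pos (exp x - 1 - x)). pose proof (Rabs_pos (cos y)). nra. }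
  assert (T2 : Rabs ((exp x - 1 - x) * sin y) <= e * r).
  { rewrite Rabs_mult. pose proof (Rabs_pos (exp x - 1 - x)). pose proof (Rabs_pos (sin y)). nra. }
  assert (T3 : Rabs ((1 + x) * (cos y - 1)) <= 2 * (e * r)).
  { rewrite Rabs_mult. pose proof (Rabs_pos (1 + x)). pose proof (Rabs_pos (cos y - 1)). nra. }
  assert (T4 : Rabs ((1 + x) * (sin y - y)) <= 2 * (e * r)).
  { rewrite Rabs_mult. pose proof (Rabs_pos (1 + x)). pose proof (Rabs_pos (sin y - y)). nra. }
  assert (T5 : Rabs (x * y) <= e * r) by (rewrite Rabs_mult; nra).
  eapply Rle_trans; [apply Rplus_le_compat; [apply Rabs_triang|]|].
  { eapply Rle_trans; [apply Rabs_triang|]. apply Rplus_le_compat_r, Rabs_triang. }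
  replace (eps * r) with (7 * (e * r)) by (unfold e; field). lra.
Qed.

(** The functional equation reduces the expansion at [p] to the one at 0, multiplied by [cexp p]. *)
Lemma cdiff_cexp (p : C) : cdiff cexp p.
Proof.
  apply cdiff_eps with (cexp p). intros eps He.
  pose proof (exp_pos (fst p)) as P.
  destruct (cexp_linear_bound (eps / exp (fst p))) as [d [Hd H]].
  { now apply Rdiv_lt_0_compat. }
  exists d. split; [easy|]. intros w Hw. specialize (H _ Hw).
  replace (cexp w) with (cexp p * cexp (w - p))%C by (rewrite <- cexp_plus; f_equal; ring).
  replace (cexp p * cexp (w - p) - cexp p - cexp p * (w - p))%C
    with (cexp p * (cexp (w - p) - 1 - (w - p)))%C by ring.
  rewrite Cmod_mult, Cmod_cexp.
  apply Rle_trans with (exp (fst p) * (eps / exp (fst p) * Cmod (w - p))).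
  - apply Rmult_le_compat_l; [lra|easy].
  - right. field. lra.
Qed.

(** * Real and imaginary parts of a complex differentiable function *)

Lemma Cmod_pair_lt (x y s t d : R) :
  Rabs (x - s) < d / 2 -> Rabs (y - t) < d / 2 -> Cmod ((x, y) - (s, t)) < d.
Proof.
  intros Hx Hy. eapply Rle_lt_trans; [apply Cmod_le_abs_sum|]. simpl.
  unfold Rminus in *. lra.
Qed.

Lemma ccont_continuity_2d (f : C -> C) (s t : R) :
  ccont f (s, t) ->
  continuity_2d_pt (fun x y => Re (f (x, y))) s t /\
  continuity_2d_pt (fun x y => Im (f (x, y))) s t.
Proof.
  intros Hf. split; intros eps; destruct (Hf eps (cond_pos eps)) as [d [Hd H]];
    (assert (Hd2 : 0 < d / 2) by lra); exists (mkposreal _ Hd2); intros x y Hx Hy;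
    specialize (H _ (Cmod_pair_lt _ _ _ _ _ Hx Hy)).
  - eapply Rle_lt_trans; [|exact H]. apply (abs_fst_le_Cmod (f (x, y) - f (s, t))%C).
  - eapply Rle_lt_trans; [|exact H]. apply (abs_snd_le_Cmod (f (x, y) - f (s, t))%C).
Qed.

(** The sides of a small rectangle around [p] need not pass through [p], so increments between two
    nearby points are needed. Both values are expanded at [p] and subtracted; the error is measured
    by the distances to [p]. *)
Lemma cdiff_strict_expansion (f : C -> C) (p : C) :
  cdiff f p -> exists D, forall eps, 0 < eps -> exists d, 0 < d /\
    forall w w', Cmod (w - p) < d -> Cmod (w' - p) < d ->
      Cmod (f w - f w' - D * (w - w')) <= eps * (Cmod (w - p) + Cmod (w' - p)).
Proof.
  intros [q [Hq E]]. exists (q p). intros eps He.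
  destruct (Hq eps He) as [d [Hd H]]. exists d. split; [easy|].
  intros w w' Hw Hw'.
  replace (f w - f w' - q p * (w - w'))%C
    with ((f w - f p) - (f w' - f p) - q p * (w - w'))%C by ring.
  rewrite !E.
  replace (q w * (w - p) - q w' * (w' - p) - q p * (w - w'))%C
    with ((q w - q p) * (w - p) - (q w' - q p) * (w' - p))%C by ring.
  eapply Rle_trans; [apply Cmod_triangle_minus|]. rewrite !Cmod_mult.
  specialize (H _ Hw) as H1. specialize (H _ Hw') as H2.
  pose proof (Cmod_ge_0 (w - p)). pose proof (Cmod_ge_0 (w' - p)). nra.
Qed.

(** A Cauchy-Riemann equation: multiplying the derivative [D] by a real increment and taking the
    real part, or by an imaginary increment and taking the imaginary part, gives the same
    coefficient [fst D]. *)
Lemma cdiff_goursat_hypothesis (f : C -> C) (s t : R) :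
  cdiff f (s, t) ->
  exists r, forall eps, 0 < eps -> exists del, 0 < del /\ forall a b c d,
    a <= s <= b -> c <= t <= d -> b - a < del -> d - c < del ->
    (forall y, c <= y <= d ->
       Rabs (Re (f (b, y)) - Re (f (a, y)) - r * (b - a)) <= eps * ((b - a) + (d - c))) /\
    (forall x, a <= x <= b ->
       Rabs (Im (f (x, d)) - Im (f (x, c)) - r * (d - c)) <= eps * ((b - a) + (d - c))).
Proof.
  intros Hf. destruct (cdiff_strict_expansion _ _ Hf) as [D HD]. exists (fst D).
  (* Each of the two distances to [(s, t)] is at most [(b - a) + (d - c)], so half of [eps]
     suffices. *)
  intros eps He. destruct (HD (eps / 2)) as [del [Hdel H]]; [lra|].
  exists (del / 2). split; [lra|]. intros a b c d Hs Ht Hab Hcd.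
  assert (near : forall x y, a <= x <= b -> c <= y <= d ->
            Cmod ((x, y) - (s, t)) < del /\
            Cmod ((x, y) - (s, t)) <= (b - a) + (d - c)).
  { intros x y Hx Hy.
    assert (X : Rabs (x - s) <= b - a) by (apply Rabs_le; lra).
    assert (Y : Rabs (y - t) <= d - c) by (apply Rabs_le; lra).
    split; [apply Cmod_pair_lt; lra|].
    eapply Rle_trans; [apply Cmod_le_abs_sum|]. simpl. unfold Rminus in *. lra. }
  split.
  - intros y Hy. destruct (near b y) as [N1 N2]; [lra|lra|].
    destruct (near a y) as [N3 N4]; [lra|lra|].
    specialize (H _ _ N1 N3).
    eapply Rle_trans; [|eapply Rle_trans; [exact H|nra]].
    eapply Rle_trans; [|apply abs_fst_le_Cmod]. right. f_equal. simpl. unfold Re. ring.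
  - intros x Hx. destruct (near x d) as [N1 N2]; [lra|lra|].
    destruct (near x c) as [N3 N4]; [lra|lra|].
    specialize (H _ _ N1 N3).
    eapply Rle_trans; [|eapply Rle_trans; [exact H|nra]].
    eapply Rle_trans; [|apply abs_snd_le_Cmod]. right. f_equal. simpl. unfold Im. ring.
Qed.

(** * Means over concentric circles *)

Lemma constant_off_finite (J : R -> R) (B : list R) :
  forall lo hi, lo <= hi ->
  (forall s, lo <= s <= hi -> continuity_pt J s) ->
  (forall s0 s1, lo <= s0 -> s0 <= s1 <= hi ->
     (forall b, In b B -> ~ (s0 <= b <= s1)) -> J s0 = J s1) ->
  J lo = J hi.
Proof.
  induction B as [|x B IH]; intros lo hi Hlh Hc H.
  { apply H; try lra. intros b []. }
  (* An interval avoiding the new point [x] has only the points of [B] to avoid, so the induction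
     hypothesis applies. *)
  assert (Off : forall a b, lo <= a -> a <= b <= hi -> ~ (a <= x <= b) -> J a = J b).
  { intros a b Ha Hb Hx. apply IH; [lra| |].
    - intros s Hs. apply Hc. lra.
    - intros s0 s1 H0 H1 HB. apply H; try lra.
      intros c [<-|Hin]; [lra|auto]. }
  (* Continuity carries the value to [x]: a point [a] between [y] and [x], close enough to [x], has
     [J a = J y], which violates continuity at [x] with tolerance [|J y - J x|]. *)
  assert (Lim : forall y, lo <= y <= hi -> lo <= x <= hi -> J y = J x).
  { intros y Hy Hx. apply NNPP. intros N.
    assert (P : 0 < Rabs (J y - J x)) by (apply Rabs_pos_lt; lra).
    destruct (Hc x Hx _ P) as [d [Hd Hcont]].
    destruct (Rtotal_order y x) as [L|[->|G]]; [|now apply N|].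
    - set (a := Rmax y (x - d / 2)).
      assert (A : y <= a < x /\ x - d / 2 <= a).
      { unfold a, Rmax. destruct Rle_dec; lra. }
      rewrite (Off y a) in Hcont; try lra.
      apply (Rlt_irrefl (Rabs (J a - J x))). apply Hcont.
      split; [split; [exact I|lra]|]. simpl. unfold R_dist. rewrite Rabs_left; lra.
    - set (a := Rmin y (x + d / 2)).
      assert (A : x < a <= y /\ a <= x + d / 2).
      { unfold a, Rmin. destruct Rle_dec; lra. }
      rewrite <- (Off a y) in Hcont; try lra.
      apply (Rlt_irrefl (Rabs (J a - J x))). apply Hcont.
      split; [split; [exact I|lra]|]. simpl. unfold R_dist. rewrite Rabs_right; lra. }
  destruct (classic (lo <= x <= hi)) as [Hx|Hx].
  - rewrite (Lim lo), (Lim hi); lra.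
  - apply Off; lra.
Qed.

Lemma continuity_pt_RInt_param (u : R -> R -> R) (s a b r : R) :
  a <= b -> 0 < r ->
  (forall x t, a <= t <= b -> Rabs (x - s) <= r -> continuity_2d_pt u x t) ->
  continuity_pt (fun x => RInt (u x) a b) s.
Proof.
  intros Hab Hr Hc eps He.
  assert (He' : 0 < eps / (b - a + 1)) by (apply Rdiv_lt_0_compat; lra).
  destruct (uniform_continuity_2d_1d' u a b s) with (eps := mkposreal _ He') as [d Hd].
  { intros t Ht. apply Hc; [easy|]. rewrite Rminus_diag, Rabs_R0. lra. }
  pose proof (cond_pos d) as Pd.
  exists (Rmin d r). split; [apply Rmin_glb_lt; lra|].
  intros x [_ Hx]. simpl in Hx |- *. unfold R_dist in *.
  pose proof (Rmin_l d r). pose proof (Rmin_r d r).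
  assert (Ex : forall y, Rabs (y - s) <= r -> ex_RInt (u y) a b).
  { intros y Hy. apply continuity_2d_ex_RInt_snd; [easy|]. intros; now apply Hc. }
  assert (E : RInt (u x) a b - RInt (u s) a b = RInt (fun t => u x t - u s t) a b).
  { symmetry. apply (RInt_minus (V := R_CompleteNormedModule)); apply Ex; [lra|].
    rewrite Rminus_diag, Rabs_R0. lra. }
  rewrite E.
  apply Rle_lt_trans with ((b - a) * (eps / (b - a + 1))).
  - apply abs_RInt_le_const; [easy| |].
    + apply (ex_RInt_minus (V := R_NormedModule)); apply Ex; [lra|].
      rewrite Rminus_diag, Rabs_R0. lra.
    + intros t Ht. apply Rlt_le.
      assert (Rabs (x - s) < d) by lra.
      apply (Hd t s t x); try lra;
        try (apply Rabs_def2 in H1; lra).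
      rewrite Rminus_diag, Rabs_R0. lra.
  - apply Rmult_lt_reg_r with (b - a + 1); [lra|].
    replace ((b - a) * (eps / (b - a + 1)) * (b - a + 1)) with ((b - a) * eps) by (field; lra).
    nra.
Qed.

Lemma cexp_in_disc (s t : R) : s < 0 -> in_disc (cexp (s, t)).
Proof.
  intros Hs. unfold in_disc. rewrite Cmod_cexp, <- exp_0. now apply exp_increasing.
Qed.

(* In the coordinate [s + i t] of [cexp] circles become vertical segments, and
   the two horizontal sides of a rectangle of height [2 PI] cancel. *)
Lemma circle_mean_eq_off_finite (G : C -> C) (L : list C) (s0 s1 : R) :
  (forall z, in_disc z -> ccont G z) ->
  (forall z, in_disc z -> ~ In z L -> cdiff G z) ->
  s0 <= s1 -> s1 < 0 ->
  RInt (fun t => Re (G (cexp (s0, t)))) 0 (2 * PI) =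
  RInt (fun t => Re (G (cexp (s1, t)))) 0 (2 * PI).
Proof.
  intros Hc Hd H01 H1. pose proof PI_RGT_0 as Ppi.
  set (u := fun s t => Re (G (cexp (s, t)))). set (v := fun s t => Im (G (cexp (s, t)))).
  assert (C2 : forall s t, s < 0 -> continuity_2d_pt u s t /\ continuity_2d_pt v s t).
  { intros s t Hs. apply (ccont_continuity_2d (fun p => G (cexp p))).
    apply ccont_comp; [apply Hc, cexp_in_disc, Hs|apply cdiff_ccont, cdiff_cexp]. }
  (* The circle of radius [exp s] can meet [L] only if [s] is the logarithm of the modulus of a
     point of [L]. A point 0 in [L] yields the default value [ln 0 = 0], which lies outside the
     negative range of [s]. *)
  apply (constant_off_finite (fun s => RInt (u s) 0 (2 * PI)) (map (fun z => ln (Cmod z)) L));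
    [easy| |].
  - intros s Hs.
    (* The radius [- s / 2] keeps [x] at most [s / 2], hence negative. *)
    apply (continuity_pt_RInt_param u s 0 (2 * PI) (- s / 2)); [lra|lra|].
    intros x t _ Hx. apply C2. pose proof (Rle_abs (x - s)). lra.
  - intros a b Ha Hb HB.
    assert (E : RInt (fun t => u b t - u a t) 0 (2 * PI) = RInt (fun s => v s (2 * PI) - v s 0) a b).
    { apply goursat_rectangle; try lra.
      - intros s t Hs _. apply C2. lra.
      - intros s t Hs _. apply (cdiff_goursat_hypothesis (fun p => G (cexp p))).
        apply cdiff_comp; [|apply cdiff_cexp]. apply Hd; [apply cexp_in_disc; lra|].
        intros Hin. apply (HB s); [|lra]. apply in_map_iff. exists (cexp (s, t)).
        split; [|easy]. rewrite Cmod_cexp. apply ln_exp. }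
    assert (Z : RInt (fun s => v s (2 * PI) - v s 0) a b = 0).
    { rewrite (RInt_ext _ (fun _ => 0)).
      - rewrite RInt_const. apply Rmult_0_r.
      - intros x _. unfold v, cexp; cbn [fst snd]. rewrite cos_2PI, sin_2PI, cos_0, sin_0.
        apply Rminus_diag. }
    rewrite Z in E.
    assert (D : RInt (fun t => u b t - u a t) 0 (2 * PI) = RInt (u b) 0 (2 * PI) - RInt (u a) 0 (2 * PI)).
    { apply (RInt_minus (V := R_CompleteNormedModule)); apply continuity_2d_ex_RInt_snd; try lra;
        intros; apply C2; lra. }
    lra.
Qed.

(** The mean does not depend on the radius, and on tiny circles it is close to [Re (G 0)] by
    continuity at 0 alone; 0 may therefore belong to [L]. *)
Lemma circle_mean_value (G : C -> C) (L : list C) (s : R) :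
  (forall z, in_disc z -> ccont G z) ->
  (forall z, in_disc z -> ~ In z L -> cdiff G z) ->
  s < 0 ->
  RInt (fun t => Re (G (cexp (s, t)))) 0 (2 * PI) = 2 * PI * Re (G 0).
Proof.
  intros Hc Hd Hs. pose proof PI_RGT_0 as Ppi.
  set (J := fun s => RInt (fun t => Re (G (cexp (s, t)))) 0 (2 * PI)).
  change (J s = 2 * PI * Re (G 0)).
  assert (Hsmall : forall eps, 0 < eps -> Rabs (J s - 2 * PI * Re (G 0)) <= 2 * PI * eps).
  { intros eps He. destruct (Hc 0) with (eps := eps) as [d [Pd H]]; [|easy|].
    { unfold in_disc. rewrite Cmod_0. lra. }
    set (s' := Rmin s (ln (d / 2))).
    assert (Hs' : s' <= s) by apply Rmin_l.
    assert (Ed : exp s' < d).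
    { apply Rle_lt_trans with (d / 2); [|lra]. rewrite <- (exp_ln (d / 2)) by lra.
      apply exp_le_mono, Rmin_r. }
    assert (EJ : J s' = J s) by (apply (circle_mean_eq_off_finite G L); auto).
    assert (Eu : ex_RInt (fun t => Re (G (cexp (s', t)))) 0 (2 * PI)).
    { apply (continuity_2d_ex_RInt_snd (fun s t => Re (G (cexp (s, t))))); [lra|]. intros t _.
      apply (ccont_continuity_2d (fun p => G (cexp p))).
      apply ccont_comp; [apply Hc, cexp_in_disc; lra|apply cdiff_ccont, cdiff_cexp]. }
    assert (B : Rabs (RInt (fun t => Re (G (cexp (s', t))) - Re (G 0)) 0 (2 * PI))
                <= (2 * PI - 0) * eps).
    { apply abs_RInt_le_const; [lra| |].
      - apply (ex_RInt_minus (V := R_NormedModule)); [exact Eu|apply ex_RInt_const].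
      - intros t _. left. eapply Rle_lt_trans; [|apply (H (cexp (s', t)))].
        + apply (abs_fst_le_Cmod (G (cexp (s', t)) - G 0)%C).
        + replace (cexp (s', t) - 0)%C with (cexp (s', t)) by ring. now rewrite Cmod_cexp. }
    rewrite RInt_minus_const in B by exact Eu.
    fold (J s') in B. rewrite EJ, Rminus_0_r in B. exact B. }
  apply NNPP. intros N.
  assert (P : 0 < Rabs (J s - 2 * PI * Re (G 0))) by (apply Rabs_pos_lt; lra).
  specialize (Hsmall (Rabs (J s - 2 * PI * Re (G 0)) / (4 * PI))).
  assert (P' : 0 < Rabs (J s - 2 * PI * Re (G 0)) / (4 * PI)) by (apply Rdiv_lt_0_compat; lra).
  specialize (Hsmall P').
  replace (2 * PI * (Rabs (J s - 2 * PI * Re (G 0)) / (4 * PI)))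
    with (Rabs (J s - 2 * PI * Re (G 0)) / 2) in Hsmall by (field; lra).
  lra.
Qed.

Lemma Re_center_le_circle (G : C -> C) (L : list C) (s m : R) :
  (forall z, in_disc z -> ccont G z) ->
  (forall z, in_disc z -> ~ In z L -> cdiff G z) ->
  s < 0 -> (forall z, Cmod z = exp s -> Re (G z) <= m) -> Re (G 0) <= m.
Proof.
  intros Hc Hd Hs Hm. pose proof PI_RGT_0 as Ppi.
  assert (B : RInt (fun t => Re (G (cexp (s, t)))) 0 (2 * PI) <= RInt (fun _ => m) 0 (2 * PI)).
  { apply RInt_le; [lra| |apply ex_RInt_const|].
    - apply (continuity_2d_ex_RInt_snd (fun s t => Re (G (cexp (s, t))))); [lra|]. intros t _.
      apply (ccont_continuity_2d (fun p => G (cexp p))).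
      apply ccont_comp; [apply Hc, cexp_in_disc; lra|apply cdiff_ccont, cdiff_cexp].
    - intros t _. apply Hm, Cmod_cexp. }
  rewrite (circle_mean_value G L), RInt_const in B by trivial.
  unfold scal in B; simpl in B; unfold mult in B; simpl in B. nra.
Qed.

(** * Blaschke factors and the maximum principle *)

Definition blaschke (a z : C) : C := ((z - a) / (1 - Cconj a * z))%C.

Lemma blaschke_den_ge (a z : C) : Cmod z <= 1 -> 1 - Cmod a <= Cmod (1 - Cconj a * z).
Proof.
  intros Hz. eapply Rle_trans; [|apply Cmod_triangle_rev].
  rewrite Cmod_1, Cmod_mult, Cmod_conj. pose proof (Cmod_ge_0 a). nra.
Qed.

Lemma blaschke_den_neq_0 (a z : C) :
  in_disc a -> in_disc z -> (1 - Cconj a * z)%C <> 0.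
Proof.
  unfold in_disc. intros Ha Hz. apply Cmod_gt_0.
  pose proof (blaschke_den_ge a z). lra.
Qed.

(** The estimates of Blaschke factors from above and below follow from this identity by bounding the
    denominator. *)
Lemma Cmod_blaschke_sqr (a z : C) :
  in_disc a -> in_disc z ->
  1 - Cmod (blaschke a z) ^ 2 =
  (1 - Cmod a ^ 2) * (1 - Cmod z ^ 2) / Cmod (1 - Cconj a * z) ^ 2.
Proof.
  intros Ha Hz. pose proof (blaschke_den_neq_0 a z Ha Hz) as N.
  unfold blaschke. rewrite Cmod_div by exact N. apply Cmod_gt_0 in N.
  assert (E : Cmod (1 - Cconj a * z) ^ 2 - Cmod (z - a) ^ 2 = (1 - Cmod a ^ 2) * (1 - Cmod z ^ 2)).
  { rewrite !Cmod2_alt. destruct a, z. simpl. ring. }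
  rewrite <- E. field. lra.
Qed.

Lemma blaschke_in_disc (a z : C) : in_disc a -> in_disc z -> in_disc (blaschke a z).
Proof.
  intros Ha Hz. pose proof (Cmod_blaschke_sqr a z Ha Hz) as E.
  pose proof (blaschke_den_neq_0 a z Ha Hz) as N. apply Cmod_gt_0 in N.
  unfold in_disc in *. pose proof (Cmod_ge_0 a). pose proof (Cmod_ge_0 z).
  assert (0 < (1 - Cmod a ^ 2) * (1 - Cmod z ^ 2) / Cmod (1 - Cconj a * z) ^ 2).
  { apply Rdiv_lt_0_compat; [|now apply pow_lt]. apply Rmult_lt_0_compat; nra. }
  pose proof (Cmod_ge_0 (blaschke a z)). nra.
Qed.

(** A Blaschke factor has modulus tending to 1 at the unit circle, uniformly: the denominator in
    [Cmod_blaschke_sqr] is at least [(1 - Cmod a) ^ 2], so it suffices that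
    [1 - Cmod z ^ 2 < kap]. *)
Lemma blaschke_near_circle (a : C) (theta : R) :
  in_disc a -> 0 <= theta < 1 ->
  exists rho, 0 <= rho < 1 /\
    forall z, rho < Cmod z < 1 -> theta < Cmod (blaschke a z).
Proof.
  intros Ha Ht. pose proof (Cmod_ge_0 a) as Pa. unfold in_disc in Ha.
  set (kap := (1 - Cmod a) ^ 2 * (1 - theta ^ 2)).
  assert (0 < kap <= 1).
  { unfold kap. assert (0 < 1 - theta ^ 2 <= 1) by nra.
    assert (0 < (1 - Cmod a) ^ 2 <= 1) by nra. nra. }
  exists (sqrt (1 - kap)).
  pose proof (sqrt_pos (1 - kap)) as P.
  assert (Sq : sqrt (1 - kap) * sqrt (1 - kap) = 1 - kap) by (apply sqrt_sqrt; lra).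
  split; [nra|]. intros z Hz.
  pose proof (Cmod_blaschke_sqr a z Ha (proj2 Hz)) as E.
  assert (D : 1 - Cmod a <= Cmod (1 - Cconj a * z)) by (apply blaschke_den_ge; lra).
  set (d := Cmod (1 - Cconj a * z)) in *.
  assert (D2 : (1 - Cmod a) ^ 2 <= d ^ 2) by nra.
  assert (Pd : 0 < d ^ 2) by nra.
  assert (Hlt : (1 - Cmod a ^ 2) * (1 - Cmod z ^ 2) / d ^ 2 < 1 - theta ^ 2).
  { apply Rmult_lt_reg_r with (d ^ 2); [easy|].
    unfold Rdiv. rewrite Rmult_assoc, Rinv_l, Rmult_1_r by lra.
    assert (0 <= Cmod a ^ 2) by nra.
    assert (0 < 1 - Cmod z ^ 2 < kap) by nra.
    assert (kap <= (1 - theta ^ 2) * d ^ 2) by (unfold kap; rewrite Rmult_comm; apply Rmult_le_compat_l; nra).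
    nra. }
  pose proof (Cmod_ge_0 (blaschke a z)). nra.
Qed.

Lemma cdiff_blaschke (a z : C) : in_disc a -> in_disc z -> cdiff (blaschke a) z.
Proof.
  intros Ha Hz. unfold blaschke, Cdiv, Cminus. apply cdiff_mult.
  - apply cdiff_plus; [apply cdiff_id|apply cdiff_const].
  - apply (cdiff_inv (fun w => (1 + - (Cconj a * w))%C)).
    + now apply blaschke_den_neq_0.
    + apply cdiff_plus; [apply cdiff_const|].
      apply cdiff_ext_near with (f := fun w => (- Cconj a * w)%C) (d := 1);
        [lra|intros; ring|].
      apply cdiff_mult; [apply cdiff_const|apply cdiff_id].
Qed.

Lemma in_disc_opp (w : C) : in_disc w -> in_disc (- w).
Proof. unfold in_disc. now rewrite Cmod_opp. Qed.

Lemma blaschke_opp_0 (w : C) : blaschke (- w) 0 = w.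
Proof. unfold blaschke. field. Qed.

(** Identifies the points of the disc that [blaschke (- w)] sends into a list [L] as images of
    points of [L] under [blaschke w]. *)
Lemma blaschke_cancel (w z : C) :
  in_disc w -> in_disc z -> blaschke w (blaschke (- w) z) = z.
Proof.
  intros Hw Hz.
  pose proof (blaschke_den_neq_0 (- w) z (in_disc_opp _ Hw) Hz) as N1.
  pose proof (blaschke_den_neq_0 w _ Hw (blaschke_in_disc (- w) z (in_disc_opp _ Hw) Hz)) as N3.
  assert (E : (blaschke (- w) z * (1 - Cconj (- w) * z))%C = (z + w)%C).
  { unfold blaschke. field. exact N1. }
  rewrite Copp_conj in *.
  set (y := blaschke (- w) z) in *. unfold blaschke.
  assert (E2 : (y - w)%C = (z * (1 - Cconj w * y))%C).
  { replace y with (y * (1 - - Cconj w * z) - y * Cconj w * z)%C at 1 by ring.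
    rewrite E. ring. }
  rewrite E2. field. exact N3.
Qed.

Definition bounded_off (L : list C) (M : R) (h : C -> C) : Prop :=
  (forall z, in_disc z -> ccont h z) /\
  (forall z, in_disc z -> ~ In z L -> cdiff h z) /\
  (forall z, in_disc z -> Cmod (h z) <= M).

(** Composition with [blaschke (- w)] brings the value at [w] to the centre, where the factor
    [Cconj (G w)] turns it into the real number [Cmod (G w) ^ 2]; the mean value inequality bounds
    this by [Cmod (G w) * (M + eps)]. *)
Lemma maximum_principle (L : list C) (G : C -> C) (M : R) :
  (forall z, in_disc z -> ccont G z) ->
  (forall z, in_disc z -> ~ In z L -> cdiff G z) ->
  (forall eps, 0 < eps -> exists rho, 0 <= rho < 1 /\
     forall z, rho < Cmod z < 1 -> Cmod (G z) <= M + eps) ->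
  forall w, in_disc w -> Cmod (G w) <= M.
Proof.
  intros Hc Hd Hb w Hw. apply le_epsilon. intros eps He.
  destruct (Hb eps He) as [rho [Hr HG]].
  (* Circles near the unit circle are sent by [blaschke (- w)] into the annulus where
     [|G| <= M + eps]. *)
  destruct (blaschke_near_circle (- w) rho (in_disc_opp _ Hw) Hr) as [r [Hr' Hbl]].
  set (r1 := (r + 1) / 2). assert (Hr1 : r < r1 < 1) by (unfold r1; lra).
  assert (Pw := Cmod_ge_0 (G w)).
  (* One point of the annulus shows the bound to be nonnegative; this settles the case [G w = 0],
     where the final inequality cannot be divided by [Cmod (G w)]. *)
  assert (PM : 0 <= M + eps).
  { apply Rle_trans with (2 := HG (RtoC ((rho + 1) / 2)) ltac:(rewrite Cmod_R, Rabs_pos_eq; lra)).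
    apply Cmod_ge_0. }
  assert (H : Re (Cconj (G w) * G (blaschke (- w) 0)) <= Cmod (G w) * (M + eps)).
  { apply (Re_center_le_circle (fun z => Cconj (G w) * G (blaschke (- w) z))%C
             (map (blaschke w) L) (ln r1)).
    - intros z Hz. apply ccont_mult; [apply ccont_const|].
      apply (ccont_comp G (blaschke (- w))).
      + apply Hc, blaschke_in_disc; auto using in_disc_opp.
      + apply cdiff_ccont, cdiff_blaschke; auto using in_disc_opp.
    - intros z Hz HL. apply cdiff_mult; [apply cdiff_const|].
      apply (cdiff_comp G (blaschke (- w))).
      + apply Hd; [apply blaschke_in_disc; auto using in_disc_opp|].
        intros Hin. apply HL. apply in_map_iff.
        exists (blaschke (- w) z). split; [now apply blaschke_cancel|easy].
      + apply cdiff_blaschke; auto using in_disc_opp.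
    - rewrite <- ln_1. apply ln_increasing; lra.
    - intros z Hz. rewrite exp_ln in Hz by lra.
      eapply Rle_trans; [apply Rle_abs|]. eapply Rle_trans; [apply re_le_Cmod|].
      rewrite Cmod_mult, Cmod_conj. apply Rmult_le_compat_l; [easy|]. apply HG. split.
      + apply Hbl. lra.
      + apply blaschke_in_disc; [now apply in_disc_opp|]. unfold in_disc. lra. }
  rewrite blaschke_opp_0 in H.
  replace (Re (Cconj (G w) * G w)) with (Cmod (G w) ^ 2) in H
    by (rewrite Cmod2_alt; destruct (G w); simpl; ring).
  nra.
Qed.

Lemma Cminus_neq_0 (a b : C) : a <> b -> (a - b)%C <> 0.
Proof.
  intros N E. apply N. replace a with ((a - b) + b)%C by ring. rewrite E. ring.
Qed.

(* The quotient by a Blaschke factor is only known to be continuous at [a];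
   this is why [bounded_off] allows exceptional points. *)
Lemma blaschke_division (L : list C) (M : R) (h : C -> C) (a : C) :
  bounded_off L M h -> in_disc a -> ~ In a L ->
  exists k, bounded_off (a :: L) (M + Cmod (h a)) k /\
    forall z, in_disc z -> h z = (h a + blaschke a z * k z)%C.
Proof.
  intros [Hc [Hd Hb]] Ha HaL. destruct (Hd a Ha HaL) as [q [Hq Eq]].
  (* Since [h z - h a] is [q z * (z - a)], dividing by the Blaschke factor leaves [q z] times its
     denominator, with no singularity at [a]. *)
  set (k := fun z => (q z * (1 + - Cconj a * z))%C).
  assert (Hk : forall z, in_disc z -> h z = (h a + blaschke a z * k z)%C).
  { intros z Hz. pose proof (blaschke_den_neq_0 a z Ha Hz) as N.
    replace (h z) with (h a + (h z - h a))%C by ring. rewrite Eq. f_equal.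
    unfold blaschke, k. field. exact N. }
  assert (Cden : forall z, cdiff (fun z => 1 + - Cconj a * z)%C z).
  { intros z. apply cdiff_plus; [apply cdiff_const|].
    apply cdiff_mult; [apply cdiff_const|apply cdiff_id]. }
  (* The disc around [z] of radius [Cmod (z - a)] misses [a]; there [q] is the difference quotient
     of [h] and inherits its regularity. *)
  assert (Eqz : forall z, z <> a -> forall w, Cmod (w - z) < Cmod (z - a) ->
            ((h w + - h a) * / (w + - a))%C = q w).
  { intros z Hz w Hw.
    assert (N : (w - a)%C <> 0).
    { apply Cminus_neq_0. intros ->. rewrite Cmod_minus_sym in Hw. lra. }
    replace (h w + - h a)%C with (q w * (w - a))%C by (rewrite <- Eq; ring). field. exact N. }
  assert (Pz : forall z, z <> a -> 0 < Cmod (z - a)).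
  { intros z Hz. now apply Cmod_gt_0, Cminus_neq_0. }
  assert (Inv : forall z, z <> a -> cdiff (fun w => / (w + - a))%C z).
  { intros z Hz. apply (cdiff_inv (fun w => w + - a)%C); [now apply Cminus_neq_0|].
    apply cdiff_plus; [apply cdiff_id|apply cdiff_const]. }
  assert (Ck : forall z, in_disc z -> ccont k z).
  { intros z Hz. unfold k. apply ccont_mult; [|apply cdiff_ccont, Cden].
    destruct (classic (z = a)) as [->|Hza]; [exact Hq|].
    apply (ccont_ext_near _ q z _ (Pz z Hza) (Eqz z Hza)).
    apply ccont_mult; [|now apply cdiff_ccont, Inv].
    apply ccont_plus; [now apply Hc|apply ccont_const]. }
  assert (Dk : forall z, in_disc z -> ~ In z (a :: L) -> cdiff k z).
  { intros z Hz HzL. unfold k. apply cdiff_mult; [|apply Cden].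
    assert (Hza : z <> a) by (intros ->; apply HzL; now left).
    apply (cdiff_ext_near _ q z _ (Pz z Hza) (Eqz z Hza)).
    apply cdiff_mult; [|now apply Inv].
    apply cdiff_plus; [|apply cdiff_const]. apply Hd; [easy|].
    intros Hin. apply HzL. now right. }
  exists k. split; [|exact Hk]. split; [exact Ck|]. split; [exact Dk|].
  apply (maximum_principle (a :: L)); trivial.
  intros eps He. set (M' := M + Cmod (h a)).
  assert (PM : 0 <= M').
  { pose proof (Cmod_ge_0 (h a)). pose proof (Hb a Ha). unfold M'. lra. }
  (* With this [theta], [|k z| > M' + eps] would force the product with the Blaschke factor above
     [M']. *)
  set (theta := (M' + eps / 2) / (M' + eps)).
  assert (Et : theta * (M' + eps) = M' + eps / 2) by (unfold theta; field; lra).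
  assert (Ht : 0 < theta < 1).
  { split; [apply Rdiv_lt_0_compat; lra|nra]. }
  destruct (blaschke_near_circle a theta Ha) as [rho [Hr Hbl]]; [lra|].
  exists rho. split; [easy|]. intros z Hz. specialize (Hbl z Hz).
  assert (Hz' : in_disc z) by (unfold in_disc; lra).
  assert (B : Cmod (blaschke a z) * Cmod (k z) <= M').
  { rewrite <- Cmod_mult.
    replace (blaschke a z * k z)%C with (h z - h a)%C by (rewrite (Hk z Hz'); ring).
    eapply Rle_trans; [apply Cmod_triangle_minus|]. specialize (Hb z Hz'). unfold M'. lra. }
  pose proof (Cmod_ge_0 (k z)). nra.
Qed.

(** * Schwarz-Pick estimates for finitely many points *)

Lemma Cmod_blaschke_le_exp (a w : C) :
  in_disc a -> in_disc w ->
  Cmod (blaschke a w) <= exp (- ((1 - Cmod w) / 8) * (1 - Cmod a)).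
Proof.
  intros Ha Hw. pose proof (Cmod_blaschke_sqr a w Ha Hw) as E.
  pose proof (blaschke_den_neq_0 a w Ha Hw) as N. apply Cmod_gt_0 in N.
  unfold in_disc in *. pose proof (Cmod_ge_0 a). pose proof (Cmod_ge_0 w).
  assert (D : Cmod (1 - Cconj a * w) <= 2).
  { eapply Rle_trans; [apply Cmod_triangle_minus|]. rewrite Cmod_1, Cmod_mult, Cmod_conj. nra. }
  set (d := Cmod (1 - Cconj a * w)) in *.
  set (x := (1 - Cmod w) / 8 * (1 - Cmod a)).
  assert (Px : 0 <= x) by (unfold x; nra).
  (* The squared denominator is at most 4, which gives [1 - |b|^2 >= 2 * x] for the Blaschke value
     [b]; then [|b|^2 <= (1 - x)^2], and [1 - x <= exp (- x)]. This is the origin of the 8. *)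
  assert (B : 2 * x <= 1 - Cmod (blaschke a w) ^ 2).
  { rewrite E. apply (Rle_div_r (2 * x) _ (d ^ 2)); [now apply pow_lt|].
    assert (d ^ 2 <= 4) by nra.
    apply Rle_trans with (8 * x); [nra|]. unfold x.
    replace (8 * ((1 - Cmod w) / 8 * (1 - Cmod a))) with ((1 - Cmod a) * (1 - Cmod w)) by field.
    apply Rmult_le_compat; nra. }
  replace (- ((1 - Cmod w) / 8) * (1 - Cmod a)) with (- x) by (unfold x; ring).
  apply Rle_trans with (1 - x).
  - assert (x <= 1) by (unfold x; nra). pose proof (Cmod_ge_0 (blaschke a w)). nra.
  - pose proof (exp_ineq1_le (- x)). lra.
Qed.

Definition defect (L : list C) : R := fold_right (fun a s => 1 - Cmod a + s) 0 L.

Lemma defect_ge_0 (L : list C) : (forall a, In a L -> in_disc a) -> 0 <= defect L.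
Proof.
  induction L as [|b L IH]; simpl; intros HL; [lra|].
  pose proof (HL b (or_introl eq_refl)) as Hb. unfold in_disc in Hb.
  assert (0 <= defect L) by (apply IH; intros; apply HL; now right). lra.
Qed.

Lemma positive_lower_bound (g : C -> R) (L : list C) :
  (forall a, In a L -> 0 < g a) -> exists d, 0 < d <= 1 /\ forall a, In a L -> d <= g a.
Proof.
  induction L as [|b L IH]; intros H.
  - exists 1. split; [lra|]. intros a [].
  - destruct IH as [d [Hd Hl]]; [intros; apply H; now right|].
    pose proof (H b (or_introl eq_refl)).
    exists (Rmin (g b) d). split; [unfold Rmin; destruct Rle_dec; lra|].
    intros a [<-|Ha]; [apply Rmin_l|].
    apply Rle_trans with d; [apply Rmin_r|auto].
Qed.

(** Induction on the points: dividing [h - h a] by [blaschke a] leaves a function still small at the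
    remaining points. [K] is fixed before [S], [M], [eps] and [h], so the induction hypothesis
    applies to the quotient with a longer exceptional list, a larger bound and a larger
    tolerance. *)
Lemma finite_schwarz_pick (L : list C) :
  NoDup L -> (forall a, In a L -> in_disc a) ->
  exists K, 0 <= K /\ forall S M eps h,
    bounded_off S M h -> (forall a, In a L -> ~ In a S) ->
    (forall a, In a L -> Cmod (h a) <= eps) -> 0 <= eps ->
    forall w, in_disc w ->
      Cmod (h w) <= M * exp (- ((1 - Cmod w) / 8) * defect L) + K * eps.
Proof.
  induction L as [|a L IH]; intros HN HL.
  { exists 0. split; [lra|]. intros S M eps h [_ [_ Hb]] _ _ _ w Hw. simpl.
    rewrite Rmult_0_r, exp_0. specialize (Hb w Hw). lra. }
  inversion HN as [|? ? HaL HN']; subst.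
  assert (Ha : in_disc a) by (apply HL; now left).
  destruct IH as [K [PK HK]]; [easy|intros; apply HL; now right|].
  (* Distinctness keeps [blaschke a] away from 0 at the remaining points; [d] limits the loss when
     dividing there. *)
  destruct (positive_lower_bound (fun b => Cmod (blaschke a b)) L) as [d [Hd Hdl]].
  { intros b Hb. unfold blaschke.
    assert (N : (1 - Cconj a * b)%C <> 0).
    { apply blaschke_den_neq_0; [easy|]. apply HL. now right. }
    rewrite Cmod_div by exact N. apply Rdiv_lt_0_compat; apply Cmod_gt_0; [|exact N].
    apply Cminus_neq_0. now intros ->. }
  (* One [eps] pays for the term [h a], one for the growth of the bound from [M] to
     [M + Cmod (h a)], and [2 * K / d] comes from the induction hypothesis with tolerance
     [2 * eps / d]. *)
  exists (2 + 2 * K / d). split.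
  { assert (0 <= K / d) by (apply Rmult_le_pos; [easy|left; apply Rinv_0_lt_compat; lra]). lra. }
  intros S M eps h Hh HS Heps He w Hw.
  destruct (blaschke_division S M h a Hh Ha) as [k [Hk Ek]]; [apply HS; now left|].
  pose proof (Heps a (or_introl eq_refl)) as Hha.
  assert (Bk : forall b, In b L -> Cmod (k b) <= 2 * eps / d).
  { intros b Hb. assert (Db : in_disc b) by (apply HL; now right).
    specialize (Hdl b Hb). cbn beta in Hdl.
    assert (B : Cmod (blaschke a b) * Cmod (k b) <= 2 * eps).
    { rewrite <- Cmod_mult.
      replace (blaschke a b * k b)%C with (h b - h a)%C by (rewrite (Ek b Db); ring).
      eapply Rle_trans; [apply Cmod_triangle_minus|].
      pose proof (Heps b (or_intror Hb)). lra. }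
    apply Rmult_le_reg_l with d; [lra|].
    replace (d * (2 * eps / d)) with (2 * eps) by (field; lra).
    pose proof (Cmod_ge_0 (k b)). nra. }
  assert (Pd : 0 <= 2 * eps / d).
  { apply Rmult_le_pos; [lra|left; apply Rinv_0_lt_compat; lra]. }
  assert (Hkw := HK (a :: S) _ (2 * eps / d) k Hk).
  specialize (Hkw ltac:(intros b Hb [->|HbS]; [now apply HaL|exact (HS b (or_intror Hb) HbS)]) Bk Pd w Hw).
  rewrite (Ek w Hw). eapply Rle_trans; [apply Cmod_triangle|]. rewrite Cmod_mult.
  pose proof (Cmod_blaschke_le_exp a w Ha Hw) as Hbl.
  pose proof (blaschke_in_disc a w Ha Hw) as Hb1. unfold in_disc in Hb1.
  pose proof (Cmod_ge_0 (blaschke a w)) as Pb.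
  simpl defect. rewrite Rmult_plus_distr_l, exp_plus.
  set (x := exp (- ((1 - Cmod w) / 8) * (1 - Cmod a))) in *.
  set (y := exp (- ((1 - Cmod w) / 8) * defect L)) in *.
  assert (Py : 0 < y) by apply exp_pos.
  assert (PM : 0 <= M).
  { destruct Hh as [_ [_ Hb]]. specialize (Hb a Ha). pose proof (Cmod_ge_0 (h a)). lra. }
  assert (Hy : y <= 1).
  { assert (0 <= defect L) by (apply defect_ge_0; intros; apply HL; now right).
    unfold in_disc in Hw. apply Rle_trans with (exp 0); [|rewrite exp_0; lra]. apply exp_le_mono. nra. }
  replace ((2 + 2 * K / d) * eps) with (eps + (eps + K * (2 * eps / d))) by (field; lra).
  assert (PKd : 0 <= K * (2 * eps / d)) by now apply Rmult_le_pos.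
  pose proof (Cmod_ge_0 (h a)).
  assert (T : Cmod (blaschke a w) * Cmod (k w)
              <= M * (x * y) + (eps + K * (2 * eps / d))).
  { apply Rle_trans with (Cmod (blaschke a w) * ((M + Cmod (h a)) * y + K * (2 * eps / d))).
    { apply Rmult_le_compat_l; [easy|]. exact Hkw. }
    assert (Cmod (blaschke a w) * (M * y) <= x * (M * y)).
    { apply Rmult_le_compat_r; [|easy]. apply Rmult_le_pos; lra. }
    assert (Cmod (h a) * y <= eps) by nra.
    assert (Cmod (blaschke a w) * (Cmod (h a) * y + K * (2 * eps / d))
            <= 1 * (eps + K * (2 * eps / d))).
    { apply Rmult_le_compat; try lra. assert (0 <= Cmod (h a) * y) by nra. lra. }
    nra. }
  lra.
Qed.

(** * Divergent Blaschke sums *)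

Lemma defect_app (L L' : list C) : defect (L ++ L') = defect L + defect L'.
Proof. induction L as [|a L IH]; simpl; [lra|]. rewrite IH. lra. Qed.

Lemma defect_map_seq (z : nat -> C) (n : nat) :
  defect (map z (seq 0 (S n))) = sum_n (fun j => 1 - Cmod (z j)) n.
Proof.
  induction n as [|n IH].
  - rewrite sum_O. simpl. lra.
  - rewrite sum_Sn, <- IH, seq_S, map_app, defect_app. unfold plus; simpl. lra.
Qed.

Lemma defect_tail_unbounded (z : nat -> C) (m : nat) (A : R) :
  is_lim_seq (sum_n (fun j => 1 - Cmod (z j))) p_infty ->
  exists k, A <= defect (map z (seq m k)).
Proof.
  intros Hdiv. apply is_lim_seq_spec in Hdiv.
  destruct (Hdiv (A + defect (map z (seq 0 m)))) as [N HN].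
  specialize (HN (N + m)%nat ltac:(lia)). rewrite <- defect_map_seq in HN.
  exists (S N). replace (S (N + m)) with (m + S N)%nat in HN by lia.
  rewrite seq_app, map_app, defect_app in HN. simpl Nat.add in HN. lra.
Qed.

(** Here [m] is both the start of the window and the lower bound for its total defect. [K] is found
    before [f], so that one sequence can serve all functions. *)
Lemma tail_schwarz_pick (z : nat -> C) (m : nat) :
  (forall j, in_disc (z j)) -> (forall i j, z i = z j -> i = j) ->
  is_lim_seq (sum_n (fun j => 1 - Cmod (z j))) p_infty ->
  exists K, 0 <= K /\ forall M eps f,
    bounded_off nil M f -> 0 <= eps -> (forall j, (m <= j)%nat -> Cmod (f (z j)) <= eps) ->
    forall w, in_disc w ->
      Cmod (f w) <= M * exp (- ((1 - Cmod w) / 8) * INR m) + K * eps.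
Proof.
  intros hdisc hinj hdiv.
  destruct (defect_tail_unbounded z m (INR m) hdiv) as [k Hk].
  destruct (finite_schwarz_pick (map z (seq m k))) as [K [PK HK]].
  - apply Injective_map_NoDup; [exact hinj|apply seq_NoDup].
  - intros a Ha. apply in_map_iff in Ha. destruct Ha as [j [<- _]]. apply hdisc.
  - exists K. split; [easy|]. intros M eps f Hf He Hz w Hw.
    eapply Rle_trans; [apply (HK nil M eps f)|]; trivial.
    + now intros a _.
    + intros a Ha. apply in_map_iff in Ha. destruct Ha as [j [<- Hj]].
      apply in_seq in Hj. apply Hz. lia.
    + apply Rplus_le_compat_r, Rmult_le_compat_l.
      * destruct Hf as [_ [_ Hb]]. pose proof (Hb w Hw). pose proof (Cmod_ge_0 (f w)). lra.
      * apply exp_le_mono. unfold in_disc in Hw. nra.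
Qed.

(** Makes the term of index [j] lie below all of [e 0, ..., e j], so that a single [e m] controls
    the whole tail from [m] on. *)
Fixpoint running_min (e : nat -> R) (n : nat) : R :=
  match n with O => e O | S n => Rmin (running_min e n) (e (S n)) end.

Lemma running_min_le (e : nat -> R) (m n : nat) : (m <= n)%nat -> running_min e n <= e m.
Proof.
  induction 1 as [|n H IH].
  - destruct m; [apply Rle_refl|apply Rmin_r].
  - eapply Rle_trans; [apply Rmin_l|exact IH].
Qed.

Lemma running_min_pos (e : nat -> R) (n : nat) : (forall k, 0 < e k) -> 0 < running_min e n.
Proof. intros He. induction n as [|n IH]; simpl; [apply He|now apply Rmin_glb_lt]. Qed.

Theorem theorem1p4 (z : nat -> C)
  (hdisc : forall j, in_disc (z j))
  (hinj : forall i j, z i = z j -> i = j)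
  (hdiv : is_lim_seq (sum_n (fun j => 1 - Cmod (z j))) p_infty) :
  exists eta : nat -> R,
    (forall j, 0 < eta j) /\ is_lim_seq eta 0 /\
    forall f : C -> C,
      analytic_on_disc f -> bounded_on_disc f ->
      (exists w : C, in_disc w /\ f w <> 0) ->
      LimSup_seq (fun j => Cmod (f (z j)) / eta j) = p_infty.
Proof.
  destruct (choice _ (fun m => tail_schwarz_pick z m hdisc hinj hdiv)) as [K HK].
  (* The factor [K m + 1] absorbs the constant of the tail estimate, and [INR m + 1] leaves a bound
     still bounded after multiplication by [m]. *)
  set (e := fun m => / ((INR m + 1) * (K m + 1))).
  assert (PK : forall m, 0 <= K m) by (intros m; apply HK).
  assert (PI1 : forall m, 0 < INR m + 1) by (intros m; pose proof (pos_INR m); lra).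
  assert (Pe : forall m, 0 < e m).
  { intros m. apply Rinv_0_lt_compat, Rmult_lt_0_compat; [auto|]. specialize (PK m). lra. }
  assert (EK : forall m, (K m + 1) * e m = / (INR m + 1)).
  { intros m. specialize (PK m). specialize (PI1 m). unfold e. field. lra. }
  exists (running_min e). split; [|split].
  - intros j. now apply running_min_pos.
  - apply is_lim_seq_le_le with (u := fun _ => 0) (w := fun n => / (INR n + 1)).
    + intros n. split; [left; now apply running_min_pos|].
      apply Rle_trans with (e n); [now apply running_min_le|].
      rewrite <- EK. specialize (PK n). specialize (Pe n). nra.
    + apply is_lim_seq_const.
    + apply (is_lim_seq_ext (fun n => / INR (S n))).
      { intros n. now rewrite S_INR. }
      apply (is_lim_seq_incr_1 (fun n => / INR n)).
      apply (is_lim_seq_inv INR p_infty); [apply is_lim_seq_INR|easy].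
  - intros f Hf [M HM] [w [Hw Hfw]].
    assert (Hbd : bounded_off nil M f).
    { split; [|split]; [| |exact HM].
      - intros x Hx. now apply cdiff_ccont, ex_derive_cdiff, Hf.
      - intros x Hx _. now apply ex_derive_cdiff, Hf. }
    (* Otherwise the ratio stays at most [A] from index [N] on. As [A] may be negative, it is
       replaced by [Rmax A 0] before the passage to larger [e m]. *)
    apply is_LimSup_seq_unique. intros A N. apply NNPP. intros Hno.
    assert (HA : forall j, (N <= j)%nat -> Cmod (f (z j)) <= Rmax A 0 * running_min e j).
    { intros j Hj. pose proof (running_min_pos e j Pe) as P.
      apply Rle_trans with (A * running_min e j).
      - apply Rle_div_l; [easy|]. apply Rnot_lt_le. intros L. apply Hno. now exists j.
      - apply Rmult_le_compat_r; [lra|apply Rmax_l]. }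
    set (A' := Rmax A 0) in HA. assert (PA : 0 <= A') by apply Rmax_r.
    apply Cmod_gt_0 in Hfw. unfold in_disc in Hw.
    set (c := (1 - Cmod w) / 8). assert (Pc : 0 < c) by (unfold c; lra).
    assert (PM : 0 <= M) by (specialize (HM w Hw); lra).
    (* Multiply the tail estimate by [m]: the exponential term is at most [M / c] because
       [x * exp (- x) <= 1], and the error term at most [A'] by the choice of [e]. A bounded
       [INR m * Cmod (f w)] contradicts [f w <> 0]. *)
    assert (Bd : forall m, (N <= m)%nat -> (0 < m)%nat -> INR m * Cmod (f w) <= M / c + A').
    { intros m Hm Hm0. apply lt_0_INR in Hm0. destruct (HK m) as [_ H].
      specialize (H M (A' * e m) f Hbd).
      assert (Pm := Pe m).
      specialize (H ltac:(nra)).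
      assert (Hz : forall j, (m <= j)%nat -> Cmod (f (z j)) <= A' * e m).
      { intros j Hj. eapply Rle_trans; [apply HA; lia|].
        apply Rmult_le_compat_l; [easy|now apply running_min_le]. }
      specialize (H Hz w Hw). fold c in H.
      assert (X : c * INR m * exp (- c * INR m) <= 1).
      { replace (- c * INR m) with (- (c * INR m)) by ring. rewrite exp_Ropp.
        pose proof (exp_ineq1_le (c * INR m)) as Ei. pose proof (exp_pos (c * INR m)) as Ep.
        apply Rmult_le_reg_r with (exp (c * INR m)); [easy|].
        rewrite Rmult_assoc, Rinv_l by lra. lra. }
      assert (Y : INR m * (K m * (A' * e m)) <= A').
      { assert (INR m * (K m * e m) <= 1).
        { apply Rle_trans with (INR m * / (INR m + 1)).
          - apply Rmult_le_compat_l; [lra|]. rewrite <- EK. lra.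
          - apply Rmult_le_reg_r with (INR m + 1); [lra|].
            rewrite Rmult_assoc, Rinv_l by lra. lra. }
        nra. }
      assert (Z : INR m * (M * exp (- c * INR m)) <= M / c).
      { apply (Rle_div_r _ M c); [easy|]. nra. }
      nra. }
    destruct (INR_unbounded ((M / c + A') / Cmod (f w))) as [m Hm].
    assert (PMc : 0 <= M / c) by (apply Rmult_le_pos; [easy|left; now apply Rinv_0_lt_compat]).
    (* The index [N + S m] is at least [N], positive, and at least the unbounded [m]. *)
    assert (Hm' : INR m <= INR (N + S m)) by (apply le_INR; lia).
    specialize (Bd (N + S m)%nat ltac:(lia) ltac:(lia)).
    apply Rgt_lt, Rlt_div_l in Hm; [|easy]. nra.
Qed.
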